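(* Let $(X_t,t\ge0)$ be an absorbed continuous-time Markov process on a finite state space $E\cup\partial$ as described in the context, with associated $\lambda_0,\lambda_1,u=(u_x)_{x\in E},v=(v_x)_{x\in E}$, and let $C$ be a constant such that, for all $x,y\in E$ and all $t\ge0$, $$|\mathbb{P}_x(X_t=y\mid t<\tau_\partial)-u_y|\le Ce^{-(\lambda_1-\lambda_0)t}\quad\text{and}\quad |e^{\lambda_0t}\mathbb{P}_x(t<\tau_\partial)-v_x|\le Ce^{-(\lambda_1-\lambda_0)t}.$$ Then, for all $x\in E$ and $t\ge0$, $$e^{\lambda_0t}+Ce^{-(\lambda_1-\lambda_0)t}-\frac{e^{\lambda_0t}-1+Ce^{-(\lambda_1-\lambda_0)t}}{u_x}\le v_x\le e^{\lambda_0t}+Ce^{-(\lambda_1-\lambda_0)t}.$$ In addition, for all $x,y\in E$ and $t\ge0$, $$\left|\mathbb{P}_x(X_t=y)-u_y\right|\le\frac{u_y}{u_x}\left(1-e^{-\lambda_0t}+Ce^{-\lambda_1t}\right)+Ce^{-\lambda_1t}\left(v_x+2u_y+Ce^{-(\lambda_1-\lambda_0)t}\right).$$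
   Context: $(X_t,t\ge0)$ is a continuous-time Markov process on a finite state space $E\cup\partial$ (disjoint union), where $\partial$ is absorbing: $X_t\in\partial$ a.s. for all $t\ge\tau_\partial:=\inf\{t\ge0:X_t\in\partial\}$. It is assumed that $\tau_\partial<\infty$ a.s., i.e. $\partial$ is accessible from any state in $E$. For $x\ne y$ in $E\cup\partial$, $q_{x,y}\ge0$ is the transition rate from $x$ to $y$, and $q_{x,x}:=-\sum_{y\neq x}q_{x,y}$. The matrix $Q:=(q_{x,y})_{x,y\in E}$ is assumed irreducible. By Perron--Frobenius theory, $Q$ has a simple real eigenvalue $-\lambda_0<0$ of maximal real part, with positive left and right eigenvectors $u,v$: $uQ=-\lambda_0u$, $Qv=-\lambda_0v$, normalized by $\sum_{x\in E}u_x=1$ and $\sum_{x\in E}u_xv_x=1$. Define $\lambda_1$ by $-\lambda_1:=\sup\{\mathrm{Re}(\lambda):\lambda\in\mathrm{Sp}(Q),\ \lambda\neq-\lambda_0\}$, where $\mathrm{Sp}(Q)$ is the spectrum of $Q$ in $\mathbb{C}$; one has $-\lambda_1<-\lambda_0<0$. $\mathbb{P}_x$ is the law of the process started from $x$. *)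

(* Defs.v *)
From HB Require Import structures.
From mathcomp Require Import all_boot all_order all_algebra.
From mathcomp Require Import all_classical all_reals all_analysis.
From mathcomp Require Import complex.

Set Implicit Arguments.
Unset Strict Implicit.
Unset Printing Implicit Defensive.

Import Order.TTheory GRing.Theory Num.Theory.
Import numFieldNormedType.Exports.

Local Open Scope classical_set_scope.
Local Open Scope ring_scope.

Section AbsorbedProcess.

                                                                              
                                                                            
                                                                          
               
Context {d : measure_display} {Omega : measurableType d} {R : realType}.
Context {E D : finType}.
Implicit Types (P : E + D -> probability Omega R) (X : R -> Omega -> E + D)
  (q : E + D -> E + D -> R) (s t h : R) (x y z : E + D) (w : Omega).

Definition at_state X t y : set Omega := [set w | X t w = y].

Definition boundary : set (E + D) := range inr.

                                                            
Definition absorption_time X w : \bar R :=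
  ereal_inf [set t%:E | t in [set t | 0 <= t /\ boundary (X t w)]].

                          
Definition survival X t : set Omega := [set w | (t%:E < absorption_time X w)%E].

Definition prob (mu : probability Omega R) (A : set Omega) : R := fine (mu A).

Definition cond_prob (mu : probability Omega R) (A B : set Omega) : R :=
  prob mu (A `&` B) / prob mu B.

Definition natural_filtration X t : set (set Omega) :=
  <<s [set A | exists s y, 0 <= s <= t /\ A = at_state X s y] >>.

Record markov_process P X q : Prop := MarkovProcess {
  mp_measurable : forall t y, 0 <= t -> measurable (at_state X t y) ;
  mp_right_continuous : forall w t, 0 <= t ->
    \forall s \near t^'+, X s w = X t w ;
  mp_start : forall x, P x (at_state X 0 x) = 1%E ;
  mp_markov : forall x t h y z (A : set Omega), 0 <= t -> 0 <= h ->
    natural_filtration X t A ->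
    P x (A `&` at_state X t y `&` at_state X (t + h) z) =
    (P x (A `&` at_state X t y) * P y (at_state X h z))%E ;
  mp_rate_ge0 : forall x y, x != y -> 0 <= q x y ;
  mp_rate : forall x y, x != y ->
    prob (P x) (at_state X h y) / h @[h --> 0^'+] --> q x y ;
  mp_rate_diag : forall x, q x x = - \sum_(y | y != x) q x y }.

Record absorbed_markov_process P X q : Prop := AbsorbedMarkovProcess {
  amp_markov :> markov_process P X q ;
  amp_absorbing : forall x, {ae P x, forall w, forall t, 0 <= t ->
    (absorption_time X w <= t%:E)%E -> boundary (X t w)} ;
  amp_accessible : forall x, {ae P x, forall w, (absorption_time X w < +oo)%E} }.

End AbsorbedProcess.

Section Spectral.

Context {R : realType} {E D : finType}.

                                                                          
                                 
Definition rate_matrix (q : E + D -> E + D -> R) : 'M[R]_#|E| :=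
  \matrix_(i, j) q (inl (enum_val i)) (inl (enum_val j)).

Definition row_of (f : E -> R) : 'rV[R]_#|E| := \row_i f (enum_val i).

Definition col_of (f : E -> R) : 'cV[R]_#|E| := \col_i f (enum_val i).

Definition irreducible_mx n (A : 'M[R]_n) : Prop :=
  forall i j, connect [rel k l | A k l != 0] i j.

Definition spectrum n (A : 'M[R]_n) : set R[i] :=
  [set z | eigenvalue (map_mx (real_complex R) A) z].

Record perron_data (Q : 'M[R]_#|E|) (lambda0 : R) (u v : E -> R) : Prop :=
  PerronData {
    perron_gt0 : 0 < lambda0 ;
    perron_simple : mup (- lambda0) (char_poly Q) = 1%N ;
    perron_max : forall z, spectrum Q z -> complex.Re z <= - lambda0 ;
    perron_left_gt0 : forall x, 0 < u x ;
    perron_right_gt0 : forall x, 0 < v x ;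
    perron_left : row_of u *m Q = (- lambda0) *: row_of u ;
    perron_right : Q *m col_of v = (- lambda0) *: col_of v ;
    perron_left_sum : \sum_x u x = 1 ;
    perron_pairing : \sum_x u x * v x = 1 }.

                                                                         
                                                                       
Definition second_rate n (Q : 'M[R]_n) (lambda0 : R) : \bar R :=
  (- ereal_sup [set (complex.Re z)%:E |
       z in [set z | spectrum Q z /\ z != real_complex R (- lambda0)]])%E.

                                                                        
                
Definition exp_decay (a : \bar R) (t : R) : R := fine (expeR (- (a * t%:E))%E).

End Spectral.

(* Main.v *)
Require Import Defs.
From HB Require Import structures.
From mathcomp Require Import all_boot all_order all_algebra.
From mathcomp Require Import all_classical all_reals all_analysis.
From mathcomp Require Import complex.
From mathcomp Require Import ring lra.

Import Order.TTheory GRing.Theory Num.Theory.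
Local Open Scope classical_set_scope.
Local Open Scope ring_scope.

(** Write [a = exp(lambda0 t)], [K = C exp(-(lambda1 - lambda0) t)] and
    [p = P_x(t < tau)].  The upper bound is [v_x <= a p + K <= a + K]; inserting
    it for every state but [x] in [sum u_z v_z = 1] gives the lower bound.  For
    the last estimate, [P_x(X_t = y) = P_x(X_t = y | t < tau) p], so the distance
    to [u_y] is at most [K p + u_y (1 - p)], and [|a p - v_x| <= K] together with
    the lower bound on [v_x] gives [p <= (v_x + K) / a] and
    [1 - p <= (1 - 1/a + K/a) / u_x]. *)

Section Survival.
Context {R : realType} {E D : finType} {d : measure_display}.
Context {Omega : measurableType d}.
Variable X : R -> Omega -> E + D.
Hypothesis Xrc : forall w (t : R), 0 <= t -> \forall s \near t^'+, X s w = X t w.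

Lemma right_constant w (t : R) : 0 <= t ->
  exists2 e : R, 0 < e & forall s, t < s < t + e -> X s w = X t w.
Proof.
move=> /(Xrc w); rewrite near_withinE => /nbhs_ballP[e /= e0 He].
exists e => // s /andP[ts se]; apply: He => //.
by rewrite /ball /= ltr_norml; apply/andP; split; lra.
Qed.

(* Right-continuity makes the infimum defining the absorption time attained. *)
Lemma survivalP (t : R) w : 0 <= t ->
  survival X t w <-> forall s, 0 <= s <= t -> ~ boundary (X s w).
Proof.
move=> t0; split.
  move=> tau s /andP[s0 st] bs; move: tau; apply/negP; rewrite -leNgt.
  by apply: (@le_trans _ _ s%:E); [apply: ereal_inf_lbound; exists s|rewrite lee_fin].
(* Strictness of [t < tau] comes from right-continuity at [t]: the path also avoids the boundary on
   [(t, t + e)], so the infimum is at least [t + e]. *)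
move=> nb; have [e e0 He] := right_constant w t t0.
apply: (@lt_le_trans _ _ (t + e)%:E); first by rewrite lte_fin; lra.
apply: le_ereal_inf_tmp => _ [s [s0 bs] <-]; rewrite lee_fin leNgt.
apply/negP => ste; have [st|ts] := leP s t.
  by apply: (nb s) => //; rewrite s0 st.
by apply: (nb t); rewrite ?t0 ?lexx// -(He s)// ts ste.
Qed.

Hypothesis Xmeas : forall (t : R) y, 0 <= t -> measurable (at_state X t y).

Lemma measurable_at_boundary (t : R) : 0 <= t ->
  measurable [set w | boundary (X t w)].
Proof.
move=> t0.
have -> : [set w | boundary (X t w)] = \bigcup_(z in [set: D]) at_state X t (inr z).
  apply/seteqP; split => w /=; first by move=> [z _ zX]; exists z.
  by move=> [z _ zX]; exists z.
by apply: fin_bigcup_measurable => // z _; exact: Xmeas.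
Qed.

(** The complement is an uncountable union over times in [[0, t]]; right-continuity reduces it to
    the rational times together with [t] itself. *)
Lemma measurable_survival (t : R) : 0 <= t -> measurable (survival X t).
Proof.
move=> t0; rewrite -(setCK (survival X t)); apply: measurableC.
pose F (r : rat) : set Omega :=
  if 0 <= (ratr r : R) <= t then [set w | boundary (X (ratr r) w)] else set0.
have -> : ~` survival X t = [set w | boundary (X t w)] `|` \bigcup_r F r.
  apply/seteqP; split => w /=.
    move=> /(survivalP _ _ t0)/existsNP[s /not_implyP[/andP[s0 st] /contrapT bs]].
    (* A hit at the endpoint [t] needs its own term, since the rationals approach a time from the
       right and would leave [[0, t]]. *)
    have [->|sNt] := eqVneq t s; first by left.
    have {sNt}st : s < t by rewrite lt_neqAle st eq_sym sNt.
    right; have [e e0 He] := right_constant w s s0.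
    (* The path keeps its value on [(s, s + e)], so a boundary hit at [s] is still seen at a
       rational time before [t]. *)
    have [r] : exists r, ratr r \in `]s, (Num.min t (s + e))[.
      by apply: rat_in_itvoo; rewrite lt_min st ltrDl.
    rewrite in_itv/= lt_min => /and3P[sr rt re].
    exists r => //; rewrite /F (le_trans s0 (ltW sr)) (ltW rt)/=.
    by rewrite He// sr re.
  move=> bX /(survivalP _ _ t0) nb; case: bX => [bt|[r _]].
    by apply: (nb t) => //; rewrite t0 lexx.
  by rewrite /F; case: ifP => // rt; exact: nb.
apply: measurableU; first exact: measurable_at_boundary.
apply: bigcupT_measurable_rat => r; rewrite /F; case: ifP => // /andP[r0 _].
exact: measurable_at_boundary.
Qed.

End Survival.

Section Probabilities.
Context {R : realType} {d : measure_display} {Omega : measurableType d}.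
Implicit Types (mu : probability Omega R) (A B : set Omega).

Lemma prob_ge0 mu A : 0 <= prob mu A.
Proof. exact: fine_ge0. Qed.

Lemma le_prob mu A B : measurable A -> measurable B -> A `<=` B ->
  prob mu A <= prob mu B.
Proof.
move=> mA mB AB; apply: fine_le; rewrite ?fin_num_measure//.
by apply: le_measure; rewrite ?inE.
Qed.

Lemma prob_le1 mu A : measurable A -> prob mu A <= 1.
Proof.
move=> mA; rewrite -lee_fin /prob fineK ?fin_num_measure//.
exact: probability_le1.
Qed.

(* Holds also when [prob mu B = 0], where [cond_prob] is the junk value [0]. *)
Lemma cond_probM mu A B : measurable A -> measurable B ->
  cond_prob mu A B * prob mu B = prob mu (A `&` B).
Proof.
move=> mA mB; have [B0|B0] := eqVneq (prob mu B) 0; last by rewrite divfK.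
apply/esym/eqP; rewrite B0 mulr0 eq_le prob_ge0 andbT -B0.
by apply: le_prob => //; exact: measurableI.
Qed.

Lemma prob_setI_ae mu A B : measurable A -> measurable B ->
  {ae mu, forall w, A w -> B w} -> prob mu (A `&` B) = prob mu A.
Proof.
move=> mA mB AB; congr fine; rewrite [RHS](measureDI _ mA mB).
rewrite [X in (X + _)%E]measure_negligible ?add0e//; first exact: measurableD.
by apply: negligibleS AB => w [Aw nBw] /(_ Aw).
Qed.

End Probabilities.

(** A path absorbed by time [t] is almost surely in the boundary at [t], so being in [E] at [t]
    almost surely entails survival. *)
Lemma prob_at_state_survival {R : realType} {E D : finType}
    {d : measure_display} {Omega : measurableType d}
    {P : E + D -> probability Omega R} {X : R -> Omega -> E + D}
    {q : E + D -> E + D -> R} (hX : absorbed_markov_process P X q)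
    (x : E + D) (y : E) (t : R) : 0 <= t ->
  prob (P x) (at_state X t (inl y)) =
  cond_prob (P x) (at_state X t (inl y)) (survival X t) *
  prob (P x) (survival X t).
Proof.
move=> t0; have [[Xmeas Xrc _ _ _ _ _] absX _] := hX.
have mS := measurable_survival _ Xrc Xmeas t t0.
rewrite cond_probM ?prob_setI_ae//; try exact: Xmeas.
apply: filterS (absX x) => w /(_ t t0) absw Xy.
rewrite /survival /= ltNge; apply/negP => /absw[z _].
by rewrite Xy.
Qed.

(** The rate is extended: [second_rate] is [+oo] when the spectrum is reduced to [- lambda0]. For
    infinite [a], both sides are [1] at [t = 0], where the product with [0] is [0], and [0] for
    [t > 0]; with [a = -oo] this is because [fine] sends [+oo] to [0]. *)
Lemma exp_decayB {R : realType} (a : \bar R) (b t : R) : 0 <= t ->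
  expR (- (b * t)) * exp_decay (a - b%:E)%E t = exp_decay a t.
Proof.
rewrite /exp_decay; case: a => [r _| |] /=.
- by rewrite -expRD; congr expR; ring.
- rewrite le_eqVlt => /orP[/eqP <-|t0].
    by rewrite !mule0 mulr0 oppr0 oppe0 /= expR0 mulr1.
  by rewrite gt0_mulye ?lte_fin//= mulr0.
- rewrite le_eqVlt => /orP[/eqP <-|t0].
    by rewrite !mule0 mulr0 oppr0 oppe0 /= expR0 mulr1.
  by rewrite gt0_mulNye ?lte_fin//= mulr0.
Qed.

Lemma weighted_sum_lower_bound {R : realFieldType} {I : finType}
    (u v : I -> R) (M : R) (x : I) :
  (forall z, 0 < u z) -> (forall z, v z <= M) ->
  \sum_z u z = 1 -> \sum_z u z * v z = 1 ->
  M - (M - 1) / u x <= v x.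
Proof.
move=> u0 vM u1 uv1.
have : 1 - u x * v x <= (1 - u x) * M.
  (* The left [1] becomes the sum of [u z * v z] and the right one the sum of [u z]; cancelling the
     terms at [x] leaves a termwise comparison. *)
  rewrite -{1}uv1 -u1 !(bigD1 (P := predT) x)//= ![u x + _]addrC ![_ * _ + _]addrC.
  rewrite !addrK mulr_suml; apply: ler_sum => z _.
  by rewrite ler_wpM2l// ltW.
move=> h; rewrite lerBlDr addrC -lerBlDr ler_pdivlMr//; lra.
Qed.

Lemma dist_le_of_quasi_stationary_bounds {R : realFieldType}
    (a c p u v w K : R) : 0 < a -> 0 <= u -> 0 < w -> 0 <= p <= 1 ->
  `|c - u| <= K -> `|a * p - v| <= K ->
  a + K - (a - 1 + K) / w <= v ->
  `|c * p - u| <= u / w * (1 - a^-1 + K * a^-1) +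
                  K * a^-1 * (v + 2 * u + K).
Proof.
move=> a0 u0 w0 /andP[p0 p1] cu /ler_normlP[pl pu] vl.
(* The sign of [K] follows from its bounding an absolute value. *)
have K0 : 0 <= K := le_trans (normr_ge0 _) cu.
have b0 : 0 < a^-1 by rewrite invr_gt0.
have hp : p <= a^-1 * (v + K) by rewrite mulrC ler_pdivlMr//; lra.
have hq : 1 - p <= w^-1 * (1 - a^-1 + K * a^-1).
  (* Here [a - a * p <= a + K - v], and the lower bound [vl] gives
     [a + K - v <= (a - 1 + K) / w]. *)
  suff : a * (1 - p) <= a * (w^-1 * (1 - a^-1 + K * a^-1)) by rewrite ler_pM2l.
  have -> : a * (w^-1 * (1 - a^-1 + K * a^-1)) = (a - 1 + K) / w.
    by field; rewrite !gt_eqF.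
  lra.
have -> : c * p - u = (c - u) * p - u * (1 - p) by ring.
apply: (le_trans (ler_normB _ _)).
rewrite !normrM (ger0_norm p0) (ger0_norm u0) (@ger0_norm _ (1 - p)) ?subr_ge0//.
have h1 : `|c - u| * p <= K * (a^-1 * (v + K)).
  by apply: ler_pM => //; exact: normr_ge0.
have h2 : u * (1 - p) <= u * (w^-1 * (1 - a^-1 + K * a^-1)).
  by rewrite ler_wpM2l.
(* [h1] and [h2] add up to the claimed bound without its [2 * u] term, which only enlarges it. *)
have h3 : 0 <= K * a^-1 * (2 * u) by rewrite !mulr_ge0// ltW.
lra.
Qed.

Theorem proposition4p1 (R : realType) (E D : finType)
    (d : measure_display) (Omega : measurableType d)
    (P : E + D -> probability Omega R) (X : R -> Omega -> E + D)
    (q : E + D -> E + D -> R) (lambda0 : R) (lambda1 : \bar R) (u v : E -> R)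
    (C : R)
    (hX : absorbed_markov_process P X q)
    (hQ : irreducible_mx (rate_matrix q))
    (huv : perron_data (rate_matrix q) lambda0 u v)
    (hlambda1 : lambda1 = second_rate (rate_matrix q) lambda0)
    (hCu : forall (x y : E) (t : R), 0 <= t ->
      `|cond_prob (P (inl x)) (at_state X t (inl y)) (survival X t) - u y|
        <= C * exp_decay (lambda1 - lambda0%:E)%E t)
    (hCv : forall (x : E) (t : R), 0 <= t ->
      `|expR (lambda0 * t) * prob (P (inl x)) (survival X t) - v x|
        <= C * exp_decay (lambda1 - lambda0%:E)%E t) :
  (forall (x : E) (t : R), 0 <= t ->
     expR (lambda0 * t) + C * exp_decay (lambda1 - lambda0%:E)%E t
       - (expR (lambda0 * t) - 1
            + C * exp_decay (lambda1 - lambda0%:E)%E t) / u x <= v x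
     /\ v x <= expR (lambda0 * t) + C * exp_decay (lambda1 - lambda0%:E)%E t)
  /\
  (forall (x y : E) (t : R), 0 <= t ->
     `|prob (P (inl x)) (at_state X t (inl y)) - u y|
       <= u y / u x * (1 - expR (- (lambda0 * t)) + C * exp_decay lambda1 t)
          + C * exp_decay lambda1 t
            * (v x + 2 * u y + C * exp_decay (lambda1 - lambda0%:E)%E t)).
Proof.
have [_ _ _ u0 _ _ _ u1 uv1] := huv.
have [[Xmeas Xrc _ _ _ _ _] _ _] := hX.
have p01 (x : E) t : 0 <= t -> 0 <= prob (P (inl x)) (survival X t) <= 1.
  move=> t0; rewrite prob_ge0 prob_le1//.
  exact: measurable_survival _ Xrc Xmeas t t0.
have vu (x : E) (t : R) : 0 <= t ->
    v x <= expR (lambda0 * t) + C * exp_decay (lambda1 - lambda0%:E)%E t.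
  move=> t0; have /ler_normlP[h _] := hCv x t t0.
  have /andP[_ p1] := p01 x t t0.
  have : expR (lambda0 * t) * prob (P (inl x)) (survival X t)
         <= expR (lambda0 * t) by rewrite ler_piMr// expR_ge0.
  lra.
have vl (x : E) (t : R) : 0 <= t ->
    expR (lambda0 * t) + C * exp_decay (lambda1 - lambda0%:E)%E t
    - (expR (lambda0 * t) - 1 + C * exp_decay (lambda1 - lambda0%:E)%E t) / u x
    <= v x.
  move=> t0; rewrite (addrAC (expR _) (-1)).
  by apply: weighted_sum_lower_bound => // z; exact: vu.
split=> [x t t0|x y t t0]; first by split; [exact: vl|exact: vu].
(* Splitting off [exp(-lambda0 t)] turns [C exp(-lambda1 t)] into [K / a]. *)
rewrite (prob_at_state_survival hX _ _ _ t0) -(exp_decayB _ lambda0 _ t0) expRN.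
rewrite [C * (_^-1 * _)]mulrCA [_^-1 * (C * _)]mulrC.
apply: dist_le_of_quasi_stationary_bounds.
- exact: expR_gt0.
- exact: ltW.
- exact: u0.
- exact: p01.
- exact: hCu.
- exact: hCv.
- exact: vl.
Qed.
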